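(* Let $\varGamma$ be a tropical curve. Then the rational function semifield $\operatorname{Rat}(\varGamma)$ of $\varGamma$ is finitely generated as a semifield over the tropical semifield $\boldsymbol{T} = (\boldsymbol{R} \cup \{-\infty\}, \max, +)$.
   Context: Graphs are unweighted, undirected, finite, connected, nonempty multigraphs that may have loops. The valence of a vertex is the number of incident edges, loops counted twice; a leaf end is a vertex of valence one; a leaf edge is an edge incident to a leaf end. An edge-weighted graph $(G,l)$ is a graph $G$ with a function $l : E(G) \to \boldsymbol{R}_{>0} \cup \{\infty\}$ that takes the value $\infty$ only on leaf edges. A tropical curve is the underlying topological space of an edge-weighted graph $(G,l)$ together with an identification of each edge $e$ with $[0,l(e)]$, where $[0,\infty]$ is the one-point compactification of $[0,\infty)$; if $l(e)=\infty$, the leaf end of $e$ is identified with $\infty$ (if $E(G)=\{e\}$ and $l(e)=\infty$, either leaf end may be identified with $\infty$). Points identified with $\infty$ are called points at infinity; all other points are finite points. Distances are path distances, and the distance between a point at infinity and any other point is infinite. A rational function on $\varGamma$ is either the constant function $-\infty$, or a continuous map $f : \varGamma \to \boldsymbol{R} \cup \{\pm\infty\}$ that is piecewise affine with integer slopes and finitely many pieces and that takes the values $\pm\infty$ only at points at infinity. $\operatorname{Rat}(\varGamma)$ is the set of all rational functions on $\varGamma$, with $(f \oplus g)(x) = \max\{f(x),g(x)\}$ and $(f \odot g)(x) = f(x)+g(x)$ at finite points $x$, extended continuously to points at infinity (and $f \odot (-\infty) = -\infty$). This is a semifield (a commutative semiring with $0 \neq 1$ in which every nonzero element is multiplicatively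 invertible), with zero element $-\infty$ and unit the constant function $0$; $\boldsymbol{T}$, with $a\oplus b=\max\{a,b\}$ and $a\odot b=a+b$, is included in it as the constant functions. A semifield over $\boldsymbol{T}$ is finitely generated (as a semifield over $\boldsymbol{T}$) if it has a finite subset such that the smallest subsemifield containing $\boldsymbol{T}$ and this subset is the whole semifield. *)

(* Defs.v *)
From HB Require Import structures.
From mathcomp Require Import all_boot all_order all_algebra.
From mathcomp Require Import all_classical all_reals all_analysis.
From mathcomp Require Import ring.

Set Implicit Arguments.
Unset Strict Implicit.
Unset Printing Implicit Defensive.
Import Order.TTheory GRing.Theory Num.Theory.
Import numFieldNormedType.Exports.
Local Open Scope classical_set_scope.
Local Open Scope ring_scope.

HB.mixin Record ComNzSemiRing_isSemifield S of GRing.ComNzSemiRing S := {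
  semifield_inv : forall x : S, x != 0 -> exists y : S, x * y = 1
}.

#[short(type="semifieldType")]
HB.structure Definition Semifield :=
  {S of ComNzSemiRing_isSemifield S & GRing.ComNzSemiRing S}.

(* Inverses are unique, so the last clause is closure under inversion of
   nonzero elements. *)
Definition is_subsemifield (S : semifieldType) (A : set S) : Prop :=
  [/\ A 0, A 1, (forall x y, A x -> A y -> A (x + y)),
      (forall x y, A x -> A y -> A (x * y)) &
      (forall x y, A x -> x * y = 1 -> A y)].

Definition fg_semifield_over (K S : semifieldType) (iota : {rmorphism K -> S}) :=
  exists G : set S,
    finite_set G /\ smallest (@is_subsemifield S) (range iota `|` G) = setT.

Section Tropical.
Context (R : realType).

Record tropical := Tropical { trop_val :> \bar R ; _ : trop_val != +oo%E }.

HB.instance Definition _ := [isSub for trop_val].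
HB.instance Definition _ := [Choice of tropical by <:].

Implicit Types x y z : tropical.

Fact trop_neqy x : trop_val x != +oo%E. Proof. by case: x. Qed.

Fact trop_add_subproof x y : maxe (trop_val x) (trop_val y) != +oo%E.
Proof. by rewrite maxEle; case: ifP => _; exact: trop_neqy. Qed.

Fact trop_mul_subproof x y : (trop_val x + trop_val y)%E != +oo%E.
Proof. by case: x y => [[x| |] //= _] [[y| |]]. Qed.

Definition trop_zero := @Tropical -oo%E isT.
Definition trop_one := @Tropical 0%E isT.
Definition trop_add x y := Tropical (trop_add_subproof x y).
Definition trop_mul x y := Tropical (trop_mul_subproof x y).

Fact trop_addA : associative trop_add.
Proof. by move=> x y z; apply: val_inj; rewrite /= maxA. Qed.
Fact trop_addC : commutative trop_add.
Proof. by move=> x y; apply: val_inj; rewrite /= maxC. Qed.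
Fact trop_add0 : left_id trop_zero trop_add.
Proof. by move=> x; apply: val_inj; rewrite /= maxNye. Qed.

HB.instance Definition _ :=
  GRing.isNmodule.Build tropical trop_addA trop_addC trop_add0.

Fact trop_mulA : associative trop_mul.
Proof. by move=> x y z; apply: val_inj; rewrite /= addeA. Qed.
Fact trop_mulC : commutative trop_mul.
Proof. by move=> x y; apply: val_inj; rewrite /= addeC. Qed.
Fact trop_mul1 : left_id trop_one trop_mul.
Proof. by move=> x; apply: val_inj; rewrite /= add0e. Qed.
Fact trop_mul0 : left_zero trop_zero trop_mul.
Proof. by move=> x; apply: val_inj; rewrite /= addNye. Qed.

Lemma maxe_addl (a b c : \bar R) : (maxe a b + c = maxe (a + c) (b + c))%E.
Proof.
have [ab|/ltW ba] := leP a b; first by rewrite (max_r (leeD2r c ab)).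
by rewrite (max_l (leeD2r c ba)).
Qed.

Fact trop_mulDl : left_distributive trop_mul trop_add.
Proof. by move=> x y z; apply: val_inj; rewrite /= maxe_addl. Qed.
Fact trop_one_neq0 : trop_one != 0.
Proof. by []. Qed.

HB.instance Definition _ := GRing.Nmodule_isComNzSemiRing.Build tropical
  trop_mulA trop_mulC trop_mul1 trop_mulDl trop_mul0 trop_one_neq0.

Fact trop_inv x : x != 0 -> exists y, x * y = 1.
Proof.
case: x => [[r| |] //= ry] _; exists (@Tropical (- r)%:E isT).
by apply: val_inj; rewrite /= -EFinD subrr.
Qed.

HB.instance Definition _ := ComNzSemiRing_isSemifield.Build tropical trop_inv.

End Tropical.

(* A finite connected nonempty multigraph; [src] and [tgt] fix an orientation
   of every edge, and loops and parallel edges are allowed. *)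
Record multigraph := MultiGraph {
  vert : finType ;
  edge : finType ;
  src : edge -> vert ;
  tgt : edge -> vert ;
  vert_gt0 : (0 < #|vert|)%N ;
  vert_connect : forall u v : vert,
    connect (fun x y => [exists e, ((src e == x) && (tgt e == y))
                                || ((src e == y) && (tgt e == x))]) u v
}.

Definition valence (G : multigraph) (v : vert G) : nat :=
  (#|[set e : edge G | src e == v]%SET| + #|[set e : edge G | tgt e == v]%SET|)%N.

Definition leaf_end (G : multigraph) (v : vert G) : bool := valence v == 1%N.

Definition leaf_edge (G : multigraph) (e : edge G) : bool :=
  leaf_end (src e) || leaf_end (tgt e).

Record weighted_graph (R : realType) := WeightedGraph {
  wgraph :> multigraph ;
  len : edge wgraph -> \bar R ;
  len_gt0 : forall e, (0 < len e)%E ;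
  len_leaf : forall e, len e = +oo%E -> leaf_edge e
}.

(* The identification of each edge e with [0, len e] is the one given by the
   orientation: src e is at 0 and tgt e at len e.  Hence on an edge of infinite
   length, tgt e must be a leaf end. *)
Record tropical_curve (R : realType) := TropicalCurve {
  curve_graph :> weighted_graph R ;
  infty_leaf : forall e : edge curve_graph,
    len e = +oo%E -> leaf_end (tgt e)
}.

Section Points.
Context (R : realType) (C : tropical_curve R).

Inductive point :=
| Vertex of vert C
| Inner (e : edge C) of {r : R | (0 < r) && (r%:E < len e)%E}.

HB.instance Definition _ := gen_eqMixin point.
HB.instance Definition _ := gen_choiceMixin point.

(* The characteristic map [0, len e] -> point of the edge e, extended to \bar R
   by constants.  As fine +oo = 0, infinite arguments fall in the else branch. *)
Definition edge_map (e : edge C) (t : \bar R) : point :=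
  if insub (fine t) is Some u then @Inner e u
  else if (t <= 0)%E then Vertex (src e) else Vertex (tgt e).

Definition at_infinity (x : point) : bool :=
  if x is Vertex v then [exists e : edge C, (len e == +oo%E) && (tgt e == v)]
  else false.

Definition edge_itv (e : edge C) : set (\bar R) := [set t | (0 <= t <= len e)%E].

(* The topology obtained by gluing the intervals [0, len e] along the vertices;
   [0, +oo] carries the subspace topology of \bar R, which makes it the
   one-point compactification of [0, +oo). *)
Definition point_open (U : set point) : Prop :=
  forall e : edge C, open (edge_map e @^-1` U : set (subspace (edge_itv e))).

Fact point_openT : point_open setT.
Proof. by move=> e; rewrite preimage_setT; exact: openT. Qed.

Fact point_openI : setI_closed point_open.
Proof. by move=> U V oU oV e; rewrite preimage_setI; exact: openI. Qed.

Fact point_open_bigU (I : Type) (f : I -> set point) :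
  (forall i, point_open (f i)) -> point_open (\bigcup_i f i).
Proof.
by move=> of_ e; rewrite preimage_bigcup; apply: bigcup_open => i _; exact: of_.
Qed.

HB.instance Definition _ :=
  isOpenTopological.Build point point_openT point_openI point_open_bigU.

End Points.

Definition affine_on (R : realType) (h : \bar R -> \bar R) (a b : \bar R) :=
  exists (k : int) (c : R), forall t : R,
    (a <= t%:E <= b)%E -> h t%:E = (k%:~R * t + c)%:E.

(* 0 = t_0 < t_1 < ... < t_n = L with h affine on every [t_i, t_i+1]. *)
Definition piecewise_affine (R : realType) (L : \bar R) (h : \bar R -> \bar R) :=
  exists s : seq (\bar R),
    path (fun a b => (a < b)%E && `[< affine_on h a b >]) 0%E s
    /\ last 0%E s = L.

Section PA.
Context (R : realType).
Implicit Types (a b x y : \bar R) (h : \bar R -> \bar R) (B : seq (\bar R)).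

Let seg h x y := exists s : seq (\bar R),
    path (fun a b => (a < b)%E && `[< affine_on h a b >]) x s
    /\ last x s = y.

Lemma affine_on_sub h a b x y : (a <= x)%E -> (y <= b)%E ->
  affine_on h a b -> affine_on h x y.
Proof.
move=> ax yb [k [c H]]; exists k, c => t /andP[xt ty].
by apply: H; rewrite (le_trans ax xt) (le_trans ty yb).
Qed.

Lemma affine_on_seg h a b : (a < b)%E -> affine_on h a b -> seg h a b.
Proof. by move=> ab H; exists [:: b]; split=> //=; rewrite ab andbT; apply/asboolP. Qed.

Lemma seg_trans h x y z : seg h x y -> seg h y z -> seg h x z.
Proof.
move=> [s [ps ls]] [s' [ps' ls']]; exists (s ++ s').
by rewrite cat_path last_cat ls; split=> //; rewrite ps.
Qed.

Lemma seg_glue h B x y : (x < y)%E ->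
  (forall a b, (x <= a)%E -> (a < b)%E -> (b <= y)%E ->
    (forall c, c \in B -> ~~ (a < c < b)%E) -> seg h a b) -> seg h x y.
Proof.
elim: B x y => [|c B IH] x y xy H.
  by apply: H => // c; rewrite in_nil.
have [/andP[xc cy]|ncxy] := boolP (x < c < y)%E.
  apply: (@seg_trans _ _ c); apply: IH => // a b xa ab bc hB; apply: H => //.
  - exact: le_trans bc (ltW cy).
  - move=> d; rewrite in_cons => /orP[/eqP->|]; last exact: hB.
    by rewrite (le_gtF bc) andbF.
  - exact: le_trans (ltW xc) xa.
  - move=> d; rewrite in_cons => /orP[/eqP->|]; last exact: hB.
    by rewrite (le_gtF xa).
apply: IH => // a b xa ab bc hB; apply: H => //.
move=> d; rewrite in_cons => /orP[/eqP->|]; last exact: hB.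
apply: contra ncxy => /andP[ac cb].
by rewrite (le_lt_trans xa ac) (lt_le_trans cb bc).
Qed.

Lemma seg_breaks h x y : seg h x y -> exists B,
  forall a b, (x <= a)%E -> (a < b)%E -> (b <= y)%E ->
    (forall c, c \in B -> ~~ (a < c < b)%E) -> affine_on h a b.
Proof.
move=> [s [ps ls]]; exists s; elim: s x ps ls => [|c s IH] x /=.
  by move=> _ -> a b xa ab bx; have := lt_le_trans ab (le_trans bx xa); rewrite ltxx.
move=> /andP[/andP[xc /asboolP axc] ps] ls a b xa ab biy hB.
have [bc|cb] := leP b c; first exact: affine_on_sub axc.
apply: (IH c) => //; last by move=> d ds; apply: hB; rewrite in_cons ds orbT.
have := hB c (mem_head _ _); rewrite cb andbT -leNgt //.
Qed.

Lemma affine_on_seg2 f g h x y : (x < y)%E ->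
  (forall a b, (x <= a)%E -> (a < b)%E -> (b <= y)%E ->
    affine_on f a b -> affine_on g a b -> seg h a b) ->
  seg f x y -> seg g x y -> seg h x y.
Proof.
move=> xy H /seg_breaks[Bf hf] /seg_breaks[Bg hg].
apply: (@seg_glue _ (Bf ++ Bg)) => // a b xa ab biy hB.
apply: H => //; [apply: hf|apply: hg] => // c cB; apply: hB;
  by rewrite mem_cat cB ?orbT.
Qed.

Lemma affine_maxl f g h a b (k k' : int) (c c' : R) :
  (forall t : R, (a <= t%:E <= b)%E -> h t%:E = maxe (f t%:E) (g t%:E)) ->
  (forall t : R, (a <= t%:E <= b)%E -> f t%:E = (k%:~R * t + c)%:E) ->
  (forall t : R, (a <= t%:E <= b)%E -> g t%:E = (k'%:~R * t + c')%:E) ->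
  (forall t : R, (a <= t%:E <= b)%E -> k'%:~R * t + c' <= k%:~R * t + c) ->
  affine_on h a b.
Proof.
move=> hh hf hg le; exists k, c => t abt.
by rewrite hh // hf // hg // max_l // lee_fin; exact: le.
Qed.

Lemma seg_max f g h a b : (a < b)%E ->
  (forall t : R, (a <= t%:E <= b)%E -> h t%:E = maxe (f t%:E) (g t%:E)) ->
  affine_on f a b -> affine_on g a b -> seg h a b.
Proof.
move=> ab hh [k [c hf]] [k' [c' hg]].
wlog kk' : k k' c c' f g hh hf hg / k%:~R <= k'%:~R :> R.
  move=> W; have [kk|/ltW kk] := leP (k%:~R : R) k'%:~R.
    exact: (W k k' c c' f g).
  by apply: (W k' k c' c g f) => // t abt; rewrite hh // maxC.
have hh' t : (a <= t%:E <= b)%E -> h t%:E = maxe (g t%:E) (f t%:E).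
  by move=> abt; rewrite hh // maxC.
have [kk|kk] := eqVneq (k%:~R : R) k'%:~R.
  apply: affine_on_seg => //.
  have [cc|/ltW cc] := leP c c'.
    by apply: (affine_maxl hh' hg hf) => t _; rewrite kk lerD2l.
  by apply: (affine_maxl hh hf hg) => t _; rewrite kk lerD2l.
have {kk kk'}kk : 0 < k'%:~R - k%:~R :> R by rewrite subr_gt0 lt_neqAle kk.
pose p : R := (c - c') / (k'%:~R - k%:~R).
have pE (t : R) : k'%:~R * t + c' - (k%:~R * t + c) = (k'%:~R - k%:~R) * (t - p).
  rewrite mulrBr /p (mulrC _ ((c - c') / _)) divfK ?gt_eqF //.
  ring.
apply: (@seg_glue _ [:: p%:E]) => // x y ax xy yb.
move=> /(_ _ (mem_head _ _)) nxpy; apply: affine_on_seg => //.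
have sub t : (x <= t%:E <= y)%E -> (a <= t%:E <= b)%E.
  by move=> /andP[xt ty]; rewrite (le_trans ax xt) (le_trans ty yb).
have [xp|px] := ltP x p%:E.
  have yp : (y <= p%:E)%E by move: nxpy; rewrite xp -leNgt.
  apply: (affine_maxl (fun t H => hh t (sub t H)) (fun t H => hf t (sub t H))
   (fun t H => hg t (sub t H))) => t /andP[_ ty].
  have := le_trans ty yp; rewrite lee_fin -subr_le0 => tp.
  by rewrite -subr_le0 pE pmulr_rle0.
apply: (affine_maxl (fun t H => hh' t (sub t H)) (fun t H => hg t (sub t H))
   (fun t H => hf t (sub t H))) => t /andP[xt _].
have := le_trans px xt; rewrite lee_fin -subr_ge0 => tp.
by rewrite -subr_ge0 pE pmulr_rge0.
Qed.

Lemma pa_max f g h (L : \bar R) : (0 < L)%E ->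
  (forall t : R, (0 <= t%:E <= L)%E -> h t%:E = maxe (f t%:E) (g t%:E)) ->
  piecewise_affine L f -> piecewise_affine L g -> piecewise_affine L h.
Proof.
move=> L0 hh; apply: affine_on_seg2 => // a b a0 ab bL; apply: seg_max => // t.
move=> /andP[at_ tb]; apply: hh.
by rewrite (le_trans a0 at_) (le_trans tb bL).
Qed.

Lemma pa_add f g h (L : \bar R) : (0 < L)%E ->
  (forall t : R, (0 <= t%:E <= L)%E -> h t%:E = (f t%:E + g t%:E)%E) ->
  piecewise_affine L f -> piecewise_affine L g -> piecewise_affine L h.
Proof.
move=> L0 hh; apply: affine_on_seg2 => // a b a0 ab bL.
move=> [k [c hf]] [k' [c' hg]]; apply: affine_on_seg => //.
exists (k + k'), (c + c') => t abt; have /andP[at_ tb] := abt.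
rewrite hh ?(le_trans a0 at_) ?(le_trans tb bL) // hf // hg // -EFinD.
by congr EFin; rewrite rmorphD /=; ring.
Qed.

Lemma pa_opp f (L : \bar R) : piecewise_affine L f ->
  piecewise_affine L (fun t => (- f t)%E).
Proof.
move=> [s [ps ls]]; exists s; split => //; apply: sub_path ps => a b.
move=> /andP[-> /asboolP[k [c hf]]] /=; apply/asboolP.
exists (- k), (- c) => t /hf ->; rewrite -EFinN rmorphN /=.
by congr EFin; ring.
Qed.

Lemma pa_cst (r : R) (L : \bar R) : (0 < L)%E ->
  piecewise_affine L (cst r%:E).
Proof.
move=> L0; apply: affine_on_seg => //; exists 0, r => t _.
by rewrite mul0r add0r.
Qed.

Lemma pa_infty f : piecewise_affine +oo%E f ->
  exists (M : R) (k : int) (c : R), forall t : R, M <= t ->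
    f t%:E = (k%:~R * t + c)%:E.
Proof.
move=> [s []]; elim/last_ind: s => [//|s y _]; rewrite rcons_path last_rcons.
move=> /andP[_ /andP[lty /asboolP[k [c hf]]]] ye.
move: lty hf; rewrite ye; case: (last _ _) => [M| |] // _ hf.
- by exists M, k, c => t Mt; apply: hf; rewrite lee_fin Mt leey.
- by exists 0, k, c => t Mt; apply: hf; rewrite leNye leey.
Qed.

End PA.

Definition is_rational (R : realType) (C : tropical_curve R)
    (f : point C -> \bar R) : Prop :=
  (forall x, f x = -oo%E) \/
  [/\ continuous f,
      forall e : edge C, piecewise_affine (len e) (f \o edge_map e) &
      forall x, ~~ at_infinity x -> f x \is a fin_num].

Section Infinity.
Context (R : realType) (C : tropical_curve R).
Implicit Types (e : edge C) (x : point C).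

Lemma edge_map_inner e (r : R) (H : (0 < r) && (r%:E < len e)%E) :
  edge_map e r%:E = Inner (exist _ r H).
Proof.
rewrite /edge_map /=; case: insubP => [u _ ur|]; last by rewrite H.
by congr (Inner _); apply: val_inj.
Qed.

Lemma edge_map0 e : edge_map e 0%E = Vertex (src e).
Proof. by rewrite /edge_map insubF /= ?ltxx // lexx. Qed.

Lemma edge_mapy e : edge_map e +oo%E = Vertex (tgt e).
Proof. by rewrite /edge_map insubF /= ?ltxx. Qed.

Lemma edge_map_len e : edge_map e (len e) = Vertex (tgt e).
Proof.
suff H t : (len e <= t)%E -> edge_map e t = Vertex (tgt e) by exact: H.
case: t => [r| |] lt; last 2 first.
- exact: edge_mapy.
- by move: (lt_le_trans (len_gt0 e) lt).
have r0 := lt_le_trans (len_gt0 e) lt.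
by rewrite /edge_map insubF /= ?(lt_geF r0) // (le_gtF lt) andbF.
Qed.

Lemma leaf_tgtP e : leaf_end (tgt e) ->
  (forall e', tgt e' = tgt e -> e' = e) /\ (forall e', src e' <> tgt e).
Proof.
rewrite /leaf_end /valence => /eqP v1.
have [n cn] : exists n, #|[set e' : edge C | tgt e' == tgt e]%SET| = n.+1.
  suff : (0 < #|[set e' : edge C | tgt e' == tgt e]%SET|)%N.
    by case: #|_| => [//|n] _; exists n.
  by apply/card_gt0P; exists e; rewrite inE.
move: v1; rewrite cn addnS => -[/eqP]; rewrite addn_eq0.
move=> /andP[/eqP s0 /eqP n0].
split=> [e' e't|e' se'].
  move: cn; rewrite n0 => /eqP /cards1P[z zE].
  have : e \in [set z]%SET by rewrite -zE inE.
  have : e' \in [set z]%SET by rewrite -zE inE e't.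
  by rewrite !inE => /eqP -> /eqP ->.
move/eqP: s0; rewrite cards_eq0 => /eqP/setP/(_ e').
by rewrite !inE se' eqxx.
Qed.

Lemma at_infinityP x : reflect (exists e, len e = +oo%E /\ x = Vertex (tgt e))
  (at_infinity x).
Proof.
apply: (iffP idP); last first.
  by move=> [e [le ->]] /=; apply/existsP; exists e; rewrite le !eqxx.
by case: x => //= v /existsP[e /andP[/eqP le /eqP <-]]; exists e.
Qed.

Lemma edge_map_finite e (t : R) : 0 <= t -> (t%:E <= len e)%E ->
  ~~ at_infinity (edge_map e t%:E).
Proof.
move=> t0 tl; have [->|tn0] := eqVneq t 0.
  rewrite edge_map0; apply/negP => /at_infinityP[e' [le' [ee']]].
  by have [_ /(_ e)] := leaf_tgtP (infty_leaf le').
have {t0 tn0}t0 : 0 < t by rewrite lt_neqAle eq_sym tn0.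
have [tle|] := ltP t%:E (len e).
  by rewrite edge_map_inner ?t0 ?tle.
move=> lt; have {tl lt} tl : t%:E = len e by apply/eqP; rewrite eq_le tl lt.
rewrite tl edge_map_len; apply/negP => /at_infinityP[e' [le' [ee']]].
have [/(_ e ee') ee _] := leaf_tgtP (infty_leaf le').
by move: tl; rewrite ee le'.
Qed.

Lemma finite_open : open [set x : point C | ~~ at_infinity x].
Proof.
move=> e; apply/open_subspaceP; exists [set t | (t < +oo)%E].
  exact: open_ereal_lt_ereal.
apply/seteqP; split=> t /= [] H; rewrite /edge_itv /= => /andP[t0 tl];
  (split; last by rewrite t0 tl).
  by case: t t0 tl H => [t| |] // t0 tl _; apply: edge_map_finite.
case: t t0 tl H => [t| |] //; first by rewrite ltry.
move=> _; rewrite leye_eq => /eqP ly /negP[].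
by rewrite edge_mapy; apply/at_infinityP; exists e.
Qed.

Lemma dnbhs_infinity e : len e = +oo%E ->
  (Vertex (tgt e) : point C)^' = (fun r : R => edge_map e r%:E) @ +oo.
Proof.
move=> le; have [tgtI srcN] := leaf_tgtP (infty_leaf le).
have inn (r : R) : 0 < r -> (0 < r) && (r%:E < len e)%E by rewrite le ltry andbT.
apply/seteqP; split=> A.
  rewrite /dnbhs /within /= nbhsE /= => -[U [oU Ux] UA].
  have /open_subspaceP[V oV VU] := oU e.
  have : nbhs +oo%E V.
    apply: open_nbhs_nbhs; split => //.
    suff : (V `&` edge_itv e) +oo%E by case.
    rewrite VU /edge_itv /= leey le lexx; split=> //.
    by rewrite edge_mapy.
  move=> [M [_ MV]]; exists (Num.max M 0); split; first exact: num_real.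
  move=> r; rewrite gt_max => /andP[Mr r0].
  apply: UA.
    suff : (edge_map e @^-1` U `&` edge_itv e) r%:E by case.
    rewrite -VU /edge_itv /=  le leey lee_fin (ltW r0); split => //.
    by apply: MV; rewrite lte_fin.
  by rewrite (edge_map_inner (inn _ r0)); apply/eqP.
move=> [M [_ MA]].
pose m := Num.max M 0.
pose U : set (point C) := [set y | y = Vertex (tgt e) \/
   exists r, m < r /\ y = edge_map e r%:E].
have m0 : 0 <= m by rewrite le_max lexx orbT.
rewrite /dnbhs /within /= nbhsE; exists U => /=; last first.
  move=> y [->|[r [mr ->]] _]; first by rewrite eqxx.
  by apply: MA; apply: le_lt_trans mr; rewrite le_max lexx.
split; last by left.
move=> e'; apply/open_subspaceP.
have [->|ne] := eqVneq e' e; last first.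
  exists set0; first exact: open0.
  rewrite set0I; apply/seteqP; split=> // t [] /= + _.
  rewrite /U /edge_map /=; case: insubP => [u _ _|_].
    case=> [//|[r [mr]]].
    rewrite -/(edge_map e r%:E) (edge_map_inner (inn r (le_lt_trans m0 mr))).
    by case=> /eqP; rewrite (negPf ne).
  case=> [|[r [mr]]].
    by case: ifP => _ [] => [/srcN|/tgtI /eqP] //; exact/negP.
  rewrite -/(edge_map e r%:E) (edge_map_inner (inn r (le_lt_trans m0 mr))).
  by case: ifP.
exists [set t | (m%:E < t)%E]; first exact: open_ereal_gt_ereal.
apply/seteqP; split=> t /= [] H; rewrite /edge_itv /= => /andP[t0 tl];
  (split; last by rewrite t0 tl).
  case: t t0 tl H => [t| |] // t0 tl; last by left; rewrite edge_mapy.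
  by rewrite lte_fin => mt; right; exists t.
case: t t0 tl H => [t| |] //; last by rewrite ltry.
rewrite lee_fin le_eqVlt => /orP[/eqP<- _|t0 _].
  rewrite edge_map0; case=> [[/srcN]//|[r [mr]]].
  by rewrite (edge_map_inner (inn r (le_lt_trans m0 mr))).
rewrite (edge_map_inner (inn t t0)); case=> [//|[r [mr]]].
rewrite (edge_map_inner (inn r (le_lt_trans m0 mr))) .
by move=> /(congr1 (fun y => if y is Inner _ u then sval u else 0)) /= => ->; rewrite lte_fin.
Qed.

Lemma dnbhs_infinity_proper x : at_infinity x -> ProperFilter x^'.
Proof.
move=> /at_infinityP[e [le ->]]; rewrite dnbhs_infinity //.
exact: fmap_proper_filter.
Qed.

Lemma near_dnbhs_finite x : at_infinity x -> \forall y \near x^', ~~ at_infinity y.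
Proof.
move=> /at_infinityP[e [le ->]]; rewrite dnbhs_infinity //.
exists 0; split=> // r r0; apply: edge_map_finite; first exact: ltW.
by rewrite le leey.
Qed.

End Infinity.

Lemma cvg_maxe (R : realType) (T : Type) (F : set_system T) (FF : Filter F)
    (f g : T -> \bar R) (a b : \bar R) :
  f x @[x --> F] --> a -> g x @[x --> F] --> b ->
  maxe (f x) (g x) @[x --> F] --> maxe a b.
Proof.
move=> fa gb.
apply: (@continuous_cvg _ _ _ F FF (fun y => (f y, g y))
  (fun z : \bar R * \bar R => maxe z.1 z.2) (a, b)).
  exact: (@max_continuous _ (\bar R)).
exact: cvg_pair.
Qed.

Section RatClosure.
Context (R : realType) (C : tropical_curve R).
Implicit Types (f g : point C -> \bar R) (x : point C).

Lemma rational_continuous f : is_rational f -> continuous f.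
Proof.
move=> [f0|[]//]; have -> : f = cst -oo%E by apply/funext.
by move=> x; apply: cst_continuous.
Qed.

Lemma rational_cvg f x : is_rational f -> f y @[y --> x^'] --> f x.
Proof.
move=> rf; apply: cvg_trans (rational_continuous rf (x := x)).
by move=> A; exact: (@nbhs_dnbhs _ x (f @^-1` A)).
Qed.

Lemma rational_ext f g : is_rational f -> is_rational g ->
  (forall x, ~~ at_infinity x -> f x = g x) -> f = g.
Proof.
move=> rf rg fg; apply/funext => x; have [xy|/fg//] := boolP (at_infinity x).
have px := dnbhs_infinity_proper xy.
have cg : f y @[y --> x^'] --> g x.
  apply: cvg_trans (rational_cvg (x := x) rg); apply: near_eq_cvg.
  by apply: filterS (near_dnbhs_finite xy) => y /fg ->.
exact: cvg_unique (rational_cvg (x := x) rf) cg.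
Qed.

Lemma affine_cvgy (k : int) (c : R) :
  cvg ((k%:~R * t + c)%:E @[t --> +oo]).
Proof.
have [k0|k0|->] := ltgtP (k%:~R : R) 0.
- suff : (k%:~R * t + c)%:E @[t --> +oo] --> -oo%E by move/cvgP.
  apply/cvgeNyPle => A.
  apply: filterS (nbhs_pinfty_ge (num_real ((k%:~R)^-1 * (A - c)))) => t.
  rewrite lee_fin -lerBrDr. by rewrite ler_ndivrMl.
- suff : (k%:~R * t + c)%:E @[t --> +oo] --> +oo%E by move/cvgP.
  apply/cvgeyPge => A.
  apply: filterS (nbhs_pinfty_ge (num_real ((k%:~R)^-1 * (A - c)))) => t.
  by rewrite lee_fin -lerBlDr ler_pdivrMl.
- have -> : (fun t => (0 * t + c)%:E) = cst c%:E.
    by apply/funext => t; rewrite mul0r add0r.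
  exact: (@is_cvg_cst (\bar R)).
Qed.

(* The pointwise sum, extended by continuity to the points at infinity, where
   f x + g x may be of the form +oo - oo. *)
Definition ratfun_mul_fun f g x : \bar R :=
  if at_infinity x then lim ((f y + g y)%E @[y --> x^']) else (f x + g x)%E.

Lemma is_rational_cst (a : \bar R) : a != +oo%E ->
  is_rational (cst a : point C -> \bar R).
Proof.
case: a => [r| |] // _; last by left.
right; split => // [x|e]; first exact: cst_continuous.
by have := pa_cst r (len_gt0 e).
Qed.

Lemma is_rational_opp f : (exists x, f x != -oo%E) -> is_rational f ->
  is_rational (fun x => - f x)%E.
Proof.
move=> [x0 fx0] [f0|[cf pf ff]]; first by rewrite f0 in fx0.
right; split => [x|e|x /ff]; last by rewrite fin_numN.
  exact: cvgeN (cf x).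
exact: pa_opp.
Qed.

Lemma is_rational_max f g : is_rational f -> is_rational g ->
  is_rational (fun x => maxe (f x) (g x)).
Proof.
move=> [f0|[cf pf ff]].
  suff -> : (fun x => maxe (f x) (g x)) = g by [].
  by apply/funext => x; rewrite f0 maxNye.
move=> [g0|[cg pg fg]].
  suff -> : (fun x => maxe (f x) (g x)) = f by right; split.
  by apply/funext => x; rewrite g0 maxeNy.
right; split=> [x|e|x xf].
- exact: cvg_maxe (cf x) (cg x).
- by apply: pa_max (pf e) (pg e); first exact: len_gt0.
- by rewrite maxEle; case: ifP => _; [exact: fg|exact: ff].
Qed.

Lemma ratfun_mul_cvg f g x : is_rational f -> is_rational g -> at_infinity x ->
  cvg ((f y + g y)%E @[y --> x^']).
Proof.
move=> rf rg xy; have px := dnbhs_infinity_proper xy.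
have cNy : (forall y, (f y + g y)%E = -oo%E) -> cvg ((f y + g y)%E @[y --> x^']).
  move=> H; have -> : (fun y => f y + g y)%E = cst -oo%E by apply/funext.
  exact: (@is_cvg_cst (\bar R)).
case: rf => [f0|[_ pf _]]; first by apply: cNy => y; rewrite f0 addNye.
case: rg => [g0|[_ pg _]]; first by apply: cNy => y; rewrite g0 addeNy.
have /at_infinityP[e [le ->]] := xy; rewrite dnbhs_infinity //.
have := pf e; rewrite le => /pa_infty[M [k [c H]]].
have := pg e; rewrite le => /pa_infty[M' [k' [c' H']]].
have /cvg_ex[l kl] := @affine_cvgy (k + k') (c + c').
apply/cvg_ex; exists l.
suff K : (f (edge_map e t%:E) + g (edge_map e t%:E))%E @[t --> +oo] --> l.
  exact: K.
apply: cvg_trans kl; apply: near_eq_cvg.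
apply: filterS2 (nbhs_pinfty_ge (num_real M)) (nbhs_pinfty_ge (num_real M')).
move=> t /H /= -> /H' /= ->.
by rewrite -EFinD; congr EFin; rewrite rmorphD /=; ring.
Qed.

Lemma is_rational_mul f g : is_rational f -> is_rational g ->
  is_rational (ratfun_mul_fun f g).
Proof.
move=> rf rg.
have cNy : (forall y, (f y + g y)%E = -oo%E) -> is_rational (ratfun_mul_fun f g).
  move=> H; left => x; rewrite /ratfun_mul_fun; case: ifPn => // xy.
  have px := dnbhs_infinity_proper xy.
  have -> : (fun y => f y + g y)%E = cst -oo%E by apply/funext.
  exact: (lim_cst (@ereal_hausdorff R)).
have rc := ratfun_mul_cvg rf rg.
case: rf => [f0|[cf pf ff]]; first by apply: cNy => y; rewrite f0 addNye.
case: rg => [g0|[cg pg fg]]; first by apply: cNy => y; rewrite g0 addeNy.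
right; split=> [x|e|x xf].
- have [xy|xf] := boolP (at_infinity x).
    have px := dnbhs_infinity_proper xy.
    have /cvg_ex[l ll] := rc _ xy.
    have cx : ratfun_mul_fun f g y @[y --> x^'] --> ratfun_mul_fun f g x.
      rewrite {2}/ratfun_mul_fun xy (cvg_lim (@ereal_hausdorff R) ll).
      apply: cvg_trans ll; apply: near_eq_cvg.
      apply: filterS (near_dnbhs_finite xy) => y /negPf yf.
      by rewrite /ratfun_mul_fun yf.
    move=> A nA; rewrite /= dnbhsE; split; first exact: cx.
    by move=> _ ->; exact: nbhs_singleton nA.
  have fgx : (f x + g x)%E = ratfun_mul_fun f g x.
    by rewrite /ratfun_mul_fun (negPf xf).
  suff K : ratfun_mul_fun f g y @[y --> x] --> (f x + g x)%E.
    by move: K; rewrite fgx.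
  apply: (@cvg_trans _ ((f y + g y)%E @[y --> x])).
    have nf : \forall y \near (x : point C), ~~ at_infinity y.
      by apply: open_nbhs_nbhs; split => //; exact: finite_open.
    apply: (@near_eq_cvg _ _ (nbhs x)); apply: (filterS _ nf).
    by move=> y /negPf yf; rewrite /ratfun_mul_fun yf.
  by apply: (@cvgeD _ (nbhs x) _ _ _ _ _ _ _ (cf x) (cg x));
    apply: fin_num_adde_defl; exact: fg.
- apply: (pa_add _ _ (pf e) (pg e)); first exact: len_gt0.
  move=> t /andP[t0 tl]; rewrite /= /ratfun_mul_fun.
  by rewrite (negPf (edge_map_finite t0 tl)).
- by rewrite /ratfun_mul_fun (negPf xf) fin_numD ff // fg.
Qed.

End RatClosure.

Section RatFun.
Context (R : realType) (C : tropical_curve R).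

Record ratfun := RatFun { ratfun_val :> point C -> \bar R ; _ : is_rational ratfun_val }.

HB.instance Definition _ := gen_eqMixin ratfun.
HB.instance Definition _ := gen_choiceMixin ratfun.

Implicit Types f g h : ratfun.

Lemma ratfunP f : is_rational f. Proof. by case: f. Qed.

Lemma ratfun_inj f g : ratfun_val f = ratfun_val g -> f = g.
Proof.
case: f g => [f rf] [g rg] /= fg; subst g; congr RatFun; exact: Prop_irrelevance.
Qed.

Lemma ratfun_ext f g : (forall x, ~~ at_infinity x -> f x = g x) -> f = g.
Proof. by move=> fg; apply/ratfun_inj/rational_ext => //; exact: ratfunP. Qed.

Definition ratfun_cst (a : tropical R) := RatFun (is_rational_cst C (trop_neqy a)).
Definition ratfun_zero := ratfun_cst 0.
Definition ratfun_one := ratfun_cst 1.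
Definition ratfun_add f g := RatFun (is_rational_max (ratfunP f) (ratfunP g)).
Definition ratfun_mul f g := RatFun (is_rational_mul (ratfunP f) (ratfunP g)).

Lemma ratfun_addE f g x : ratfun_add f g x = maxe (f x) (g x). Proof. by []. Qed.

Lemma ratfun_mulE f g x : ~~ at_infinity x -> ratfun_mul f g x = (f x + g x)%E.
Proof. by rewrite /= /ratfun_mul_fun => /negPf ->. Qed.

Fact ratfun_addA : associative ratfun_add.
Proof. by move=> f g h; apply: ratfun_ext => x _; rewrite !ratfun_addE maxA. Qed.
Fact ratfun_addC : commutative ratfun_add.
Proof. by move=> f g; apply: ratfun_ext => x _; rewrite !ratfun_addE maxC. Qed.
Fact ratfun_add0 : left_id ratfun_zero ratfun_add.
Proof. by move=> f; apply: ratfun_ext => x _; rewrite ratfun_addE maxNye. Qed.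

HB.instance Definition _ :=
  GRing.isNmodule.Build ratfun ratfun_addA ratfun_addC ratfun_add0.

Fact ratfun_mulA : associative ratfun_mul.
Proof. by move=> f g h; apply: ratfun_ext => x xf; rewrite !ratfun_mulE // addeA. Qed.
Fact ratfun_mulC : commutative ratfun_mul.
Proof. by move=> f g; apply: ratfun_ext => x xf; rewrite !ratfun_mulE // addeC. Qed.
Fact ratfun_mul1 : left_id ratfun_one ratfun_mul.
Proof. by move=> f; apply: ratfun_ext => x xf; rewrite ratfun_mulE // add0e. Qed.
Fact ratfun_mul0 : left_zero ratfun_zero ratfun_mul.
Proof. by move=> f; apply: ratfun_ext => x xf; rewrite ratfun_mulE // addNye. Qed.
Fact ratfun_mulDl : left_distributive ratfun_mul ratfun_add.
Proof.
move=> f g h; apply: ratfun_ext => x xf.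
by rewrite ratfun_addE !ratfun_mulE // ratfun_addE maxe_addl.
Qed.
Fact ratfun_one_neq0 : ratfun_one != 0.
Proof.
have /card_gt0P[v _] := vert_gt0 C.
by apply/eqP => /(congr1 (fun f : ratfun => f (Vertex v))).
Qed.

HB.instance Definition _ := GRing.Nmodule_isComNzSemiRing.Build ratfun
  ratfun_mulA ratfun_mulC ratfun_mul1 ratfun_mulDl ratfun_mul0 ratfun_one_neq0.

Fact ratfun_inv f : f != 0 -> exists g, f * g = 1.
Proof.
move=> f0; have nf : exists x, f x != -oo%E.
  apply: contrapT => /forallNP H; move/eqP: f0; apply; apply: ratfun_ext => x _.
  by apply/eqP/negPn/negP; exact: H.
exists (RatFun (is_rational_opp nf (ratfunP f))); apply: ratfun_ext => x xf.
rewrite ratfun_mulE //=; apply: subee.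
case: nf => x0 fx0; case: (ratfunP f) => [f0'|[_ _ ->//]].
by rewrite f0' eqxx in fx0.
Qed.

HB.instance Definition _ := ComNzSemiRing_isSemifield.Build ratfun ratfun_inv.

Fact ratfun_cst_nmod : nmod_morphism ratfun_cst.
Proof. by split => // a b; apply: ratfun_ext. Qed.
Fact ratfun_cst_monoid : monoid_morphism ratfun_cst.
Proof. by split => // a b; apply: ratfun_ext => x xf; rewrite ratfun_mulE. Qed.

HB.instance Definition _ :=
  GRing.isNmodMorphism.Build (tropical R) ratfun ratfun_cst ratfun_cst_nmod.
HB.instance Definition _ :=
  GRing.isMonoidMorphism.Build (tropical R) ratfun ratfun_cst ratfun_cst_monoid.

End RatFun.

(* Main.v *)
From Pilot Require Import Defs.
From mathcomp Require Import all_boot all_order all_algebra.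
From mathcomp Require Import all_classical all_reals all_analysis.
From mathcomp Require Import ring lra.

Set Implicit Arguments.
Unset Strict Implicit.
Unset Printing Implicit Defensive.
Import Order.TTheory GRing.Theory Num.Theory.
Import numFieldNormedType.Exports Pilot.Defs.
Local Open Scope classical_set_scope.
Local Open Scope ring_scope.

(** Why the theorem holds.  At finite points a nonzero rational function is
    real valued, and rational functions are determined there.  So a
    subsemifield containing the constants amounts to a set of real functions
    on the finite points that contains the constants and is closed under
    [+], [-] and [max], hence also under [min].

    On an interval the coordinate function generates everything: a piecewise
    affine function with integer slopes is obtained from [t] and constants by
    [+], [-], [max] ([plfun_of_path]), whatever its breakpoints are.  On a
    curve, the coordinate [t] of an edge need not extend to a rational
    function: the edge may be a loop.  However, its restriction to a large
    part of the edge does extend.  A chart of an edge is a pair of rational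
    functions [T], [w], where [w >= 0] and [T] is the coordinate of the edge
    on the set [w > 0].  Two charts cover an edge: with length [L], the
    function [min t (2L - 2t)] is the coordinate on [[0, 2L/3]], and
    symmetrically [max t (L - 2t)] is the coordinate on [[L/3, L]]; each takes
    the same value at both ends of the edge, hence extends to the curve by
    that constant ([edge_charts]).  On an infinite edge [T = w = t] will do.

    Let [h >= 0] be rational and zero at the finite vertices, with
    [h = f_e(t)] on the edge [e].  Then for large [n] one has
    [h = max over the charts of min (max (f_e(T)) 0) (n * w)].
    Indeed the cut-off by [n * w] makes a term vanish outside its chart, while
    inside the chart [f_e(T) = h]; and [h <= n * w] for one of the charts at
    each point, since [h] is Lipschitz and vanishes at the ends of [e]
    ([repr_in_vanishing_ge0]).

    For a general rational function, first correct the values at the vertices.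
    A rational function that is positive at [v] and zero at all other
    vertices generates, by truncating its multiples, functions with
    any prescribed value at [v] ([repr_in_vertex_value]).  After subtraction
    of a sum of these, the function vanishes at the vertices, and its
    positive and negative parts are covered by the previous case.  The
    generators are the charts and one vertex function per vertex. *)

(** * Piecewise affine functions of one real variable *)

Section PLFun.
Context (R : realType).

(** The piecewise affine functions with integer slopes, presented by their
    construction from the coordinate: this presentation is what transports
    them to any subsemifield that contains a coordinate. *)
Inductive plfun : (R -> R) -> Prop :=
| plfun_id : plfun (fun t => t)
| plfun_cst c : plfun (fun=> c)
| plfun_add f g : plfun f -> plfun g -> plfun (fun t => f t + g t)
| plfun_opp f : plfun f -> plfun (fun t => - f t)
| plfun_max f g : plfun f -> plfun g -> plfun (fun t => Num.max (f t) (g t)).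

Implicit Types f g : R -> R.

Lemma plfun_comp f g : plfun f -> plfun g -> plfun (fun t => f (g t)).
Proof.
by move=> pf pg; elim: pf; by [constructor | constructor; assumption |].
Qed.

Lemma plfun_min f g : plfun f -> plfun g ->
  plfun (fun t => Num.min (f t) (g t)).
Proof.
move=> pf pg.
rewrite (_ : (fun _ => _) = fun t => - Num.max (- f t) (- g t)).
  by do 2 constructor; constructor.
by apply/funext => t; rewrite -oppr_min opprK.
Qed.

Lemma plfun_mulz (k : int) f : plfun f -> plfun (fun t => k%:~R * f t).
Proof.
move=> pf; have pn (n : nat) : plfun (fun t => n%:R * f t).
  elim: n => [|n IH].
    rewrite (_ : (fun _ => _) = fun=> 0); first exact: plfun_cst.
    by apply/funext => t; rewrite mul0r.
  rewrite (_ : (fun _ => _) = fun t => f t + n%:R * f t).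
    exact: plfun_add.
  by apply/funext => t; rewrite -natr1 mulrDl mul1r addrC.
case: k => n; first exact: pn.
rewrite (_ : (fun _ => _) = fun t => - (n.+1%:R * f t)).
  exact/plfun_opp/pn.
by apply/funext => t; rewrite NegzE mulrNz mulNr.
Qed.

Lemma plfun_lipschitz f : plfun f ->
  exists n : nat, forall s t, `|f s - f t| <= n%:R * `|s - t|.
Proof.
elim=> [|c|{}f g _ [m Hm] _ [n Hn]|{}f _ [n Hn]|{}f g _ [m Hm] _ [n Hn]].
- by exists 1%N => s t; rewrite mul1r.
- by exists 0%N => s t; rewrite subrr normr0 mul0r.
- exists (m + n)%N => s t; rewrite natrD mulrDl.
  by rewrite opprD addrACA (le_trans (ler_normD _ _)) ?lerD.
- by exists n => s t; rewrite -opprD normrN.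
- exists (m + n)%N => s t; rewrite natrD mulrDl.
  move: (Hm s t) (Hn s t); move: (m%:R * _) (n%:R * _) => a b.
  rewrite !ler_norml => /andP[? ?] /andP[? ?].
  by rewrite !maxEle; do 2 case: ifP => ?; apply/andP; split; lra.
Qed.

(** Induction on the breakpoints, from the left: if [g] represents [h] on
    [[c, last]] and [h t = k t + d] on [[x, c]], then the sum of
    [k (min t c) + d] and [g (max t c) - g c] represents [h] on both, since
    one of the two terms is constant on each side of [c]. *)
Lemma plfun_of_path (h : \bar R -> \bar R) (s : seq (\bar R)) (x : R) :
  h x%:E \is a fin_num ->
  path (fun a b => (a < b)%E && `[< affine_on h a b >]) x%:E s ->
  exists2 f, plfun f &
    forall t : R, (x%:E <= t%:E <= last x%:E s)%E -> h t%:E = (f t)%:E.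
Proof.
elim: s x => [|c s IH] x hx /=.
  move=> _; exists (fun=> fine (h x%:E)); first exact: plfun_cst.
  move=> t; rewrite -eq_le => /eqP <-; by rewrite fineK.
move=> /andP[/andP[xc /asboolP[k [d hk]]]]; case: c xc hk => [c| |] // xc hk ps.
  have hc : h c%:E = (k%:~R * c + d)%:E by apply: hk; rewrite lexx (ltW xc).
  have [|f pf hf] := IH c _ ps; first by rewrite hc.
  exists (fun t => (k%:~R * Num.min t c + d) + (f (Num.max t c) - f c)).
    do 2 apply: plfun_add.
    - by apply: plfun_mulz; apply: plfun_min; constructor.
    - exact: plfun_cst.
    - by apply: (plfun_comp pf); apply: plfun_max; constructor.
    - exact: plfun_cst.
  have cl : (c%:E <= last c%:E s)%E.
    elim: (s) (c%:E) ps => [|y s' IH'] z //= /andP[/andP[zy _] /IH'].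
    exact: le_trans (ltW zy).
  move=> t /andP[xt tl]; have [tc|/ltW ct] := leP t c.
    by rewrite subrr addr0 hk // xt lee_fin tc.
  rewrite hf ?lee_fin ?ct //; congr EFin.
  have := hf c; rewrite lexx cl => /(_ isT); rewrite hc => -[->].
  by ring.
(* The breakpoint [c] is +oo, so it is the last one. *)
exists (fun t => k%:~R * t + d).
  by apply: plfun_add (plfun_cst _); apply/plfun_mulz/plfun_id.
by move=> t /andP[xt _]; apply: hk; rewrite xt leey.
Qed.

End PLFun.

(** * Subsemifields as sets of real functions on the finite points *)

Section Representation.
Context (R : realType) (C : tropical_curve R).
Implicit Types (p q : point C -> R) (f g : ratfun C) (A : set (ratfun C)).

(** Rational functions are determined by their values at finite points, which
    are real for nonzero functions: comparing only there keeps all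
    computations in [R]. *)
Definition repr_in A p :=
  exists2 f, A f & forall x, ~~ at_infinity x -> f x = (p x)%:E.

Lemma repr_in_ext A p q : (forall x, ~~ at_infinity x -> p x = q x) ->
  repr_in A p -> repr_in A q.
Proof. by move=> pq [f Af fp]; exists f => // x xf; rewrite fp ?pq. Qed.

Lemma src_finite (e : edge C) : ~~ at_infinity (Vertex (src e) : point C).
Proof.
by rewrite -edge_map0; apply: edge_map_finite => //; exact/ltW/len_gt0.
Qed.

Lemma finite_point : exists x : point C, ~~ at_infinity x.
Proof.
have /card_gt0P[v _] := vert_gt0 C.
have [/at_infinityP[e _]|] := boolP (at_infinity (Vertex v : point C)).
  by exists (Vertex (src e)); exact: src_finite.
by exists (Vertex v).
Qed.

Section Closure.
Context (A : set (ratfun C)) (sA : is_subsemifield A).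
Context (cA : range (@ratfun_cst R C) `<=` A).

Lemma repr_in_cst (c : R) : repr_in A (fun=> c).
Proof.
pose a := @Tropical R c%:E isT.
by exists (ratfun_cst C a) => //; apply: cA; exists a.
Qed.

Lemma repr_in_add p q : repr_in A p -> repr_in A q ->
  repr_in A (fun x => p x + q x).
Proof.
case: sA => _ _ _ mA _ [f Af fp] [g Ag gq]; exists (f * g); first exact: mA.
by move=> x xf; rewrite ratfun_mulE // fp // gq.
Qed.

Lemma repr_in_max p q : repr_in A p -> repr_in A q ->
  repr_in A (fun x => Num.max (p x) (q x)).
Proof.
case: sA => _ _ aA _ _ [f Af fp] [g Ag gq]; exists (f + g); first exact: aA.
by move=> x xf; rewrite ratfun_addE fp // gq // EFin_max.
Qed.

Lemma repr_in_opp p : repr_in A p -> repr_in A (fun x => - p x).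
Proof.
case: sA => _ _ _ _ iA [f Af fp].
have f0 : f != 0.
  by have [x xf] := finite_point; apply/eqP => f0; move: (fp x xf); rewrite f0.
have [g fg] := ratfun_inv f0; exists g; first exact: iA fg.
move=> x xf; have := ratfun_mulE f g xf.
have -> : ratfun_mul f g = 1 by [].
rewrite fp // /=; case: (g x) => [r||] //= -[] /eqP.
by rewrite eq_sym addrC addr_eq0 => /eqP ->.
Qed.

Lemma repr_in_min p q : repr_in A p -> repr_in A q ->
  repr_in A (fun x => Num.min (p x) (q x)).
Proof.
move=> Ap Aq; apply: (@repr_in_ext _ (fun x => - Num.max (- p x) (- q x))).
  by move=> x _; rewrite -oppr_min opprK.
by apply/repr_in_opp/repr_in_max; exact: repr_in_opp.
Qed.

Lemma repr_in_plfun (f : R -> R) p : plfun f -> repr_in A p ->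
  repr_in A (fun x => f (p x)).
Proof.
move=> pf Ap; elim: pf => [|c|h k _ Ah _ Ak|h _ Ah|h k _ Ah _ Ak] //.
- exact: repr_in_cst.
- exact: repr_in_add.
- exact: repr_in_opp.
- exact: repr_in_max.
Qed.

Lemma repr_in_muln (n : nat) p : repr_in A p -> repr_in A (fun x => n%:R * p x).
Proof. exact: (repr_in_plfun (plfun_mulz n (plfun_id R))). Qed.

Lemma repr_in_sum (I : Type) (r : seq I) (p : I -> point C -> R) :
  (forall i, repr_in A (p i)) -> repr_in A (fun x => \sum_(i <- r) p i x).
Proof.
move=> Ap; elim: r => [|i r IH].
  by apply: repr_in_ext (repr_in_cst 0) => x _; rewrite big_nil.
by apply: repr_in_ext (repr_in_add (Ap i) IH) => x _; rewrite big_cons.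
Qed.

Lemma repr_in_bigmax (I : Type) (r : seq I) (p : I -> point C -> R) :
  (forall i, repr_in A (p i)) ->
  repr_in A (fun x => \big[Num.max/0]_(i <- r) p i x).
Proof.
move=> Ap; elim: r => [|i r IH].
  by apply: repr_in_ext (repr_in_cst 0) => x _; rewrite big_nil.
by apply: repr_in_ext (repr_in_max (Ap i) IH) => x _; rewrite big_cons.
Qed.

End Closure.

Lemma is_subsemifieldT : is_subsemifield [set: ratfun C].
Proof. by split. Qed.

Lemma repr_inS A A' p : A `<=` A' -> repr_in A p -> repr_in A' p.
Proof. by move=> AA' [f /AA']; exists f. Qed.

Lemma repr_on_edge p (e : edge C) : repr_in setT p ->
  exists2 f, plfun f & forall t : R, 0 <= t -> (t%:E <= len e)%E ->
    p (edge_map e t%:E) = f t.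
Proof.
move=> [f _ fp].
have le0 : (0%:E <= len e)%E by exact/ltW/len_gt0.
have f0 : f (edge_map e 0%E) = (p (edge_map e 0%E))%:E.
  by apply: fp; rewrite edge_map0 src_finite.
case: (ratfunP f) => [fN|[_ /(_ e)[s [ps ls]] _]].
  by rewrite fN in f0.
have [|g pg hg] := plfun_of_path _ ps; first by rewrite /= f0.
exists g => // t t0 tl; apply: EFin_inj; rewrite -fp ?edge_map_finite //.
by apply: hg; rewrite ls lee_fin t0.
Qed.

End Representation.

(** * Gluing functions on the edges *)

(* Innermost [max] and [min] first, so that no comparison mentions another
   one. *)
Ltac case_maxmin x y :=
  lazymatch x with
  | context [Order.max] => fail
  | context [Order.min] => fail
  | _ => lazymatch y with
    | context [Order.max] => fail
    | context [Order.min] => fail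
    | _ => case: (leP x y) => ?
    end
  end.
Ltac lra_maxmin :=
  repeat match goal with
  | |- context [Order.max ?x ?y] => case_maxmin x y
  | |- context [Order.min ?x ?y] => case_maxmin x y
  end; intros; lra.

Section Gluing.
Context (R : realType).

(** A real form of the conditions on the restriction of a rational function to
    an edge of length [L].  The extension to [\bar R] provides the value at
    the point at infinity when [L] is infinite. *)
Definition extendable (L : \bar R) (f : R -> R) :=
  exists h : \bar R -> \bar R,
    [/\ continuous h, piecewise_affine L h & forall t, h t%:E = (f t)%:E].

Section Extendable.
Context (L : \bar R) (L0 : (0 < L)%E).
Implicit Types f g : R -> R.

Lemma extendable_affine (k : int) (c : R) :
  extendable L (fun t => k%:~R * t + c).
Proof.
exists (fun t => (k%:~R)%:E * t + c%:E)%E; split=> //.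
  move=> t; apply: cvgeD; [exact: fin_num_adde_defl| |exact: cvg_cst].
  by apply: cvgeZl => //; exact: cvg_id.
by apply: affine_on_seg => //; exists k, c.
Qed.

Lemma extendable_ext f g : f =1 g -> extendable L f -> extendable L g.
Proof. by move=> /funext ->. Qed.

Lemma extendable_max f g : extendable L f -> extendable L g ->
  extendable L (fun t => Num.max (f t) (g t)).
Proof.
move=> [f' [cf pf f'E]] [g' [cg pg g'E]].
exists (fun t => maxe (f' t) (g' t)); split.
- by move=> t; exact: cvg_maxe (cf t) (cg t).
- exact: pa_max pf pg.
- by move=> t; rewrite f'E g'E EFin_max.
Qed.

Lemma extendable_opp f : extendable L f -> extendable L (fun t => - f t).
Proof.
move=> [f' [cf pf f'E]]; exists (fun t => - f' t)%E; split.
- by move=> t; exact: cvgeN (cf t).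
- exact: pa_opp.
- by move=> t; rewrite f'E.
Qed.

Lemma extendable_min f g : extendable L f -> extendable L g ->
  extendable L (fun t => Num.min (f t) (g t)).
Proof.
move=> ef eg; apply: (@extendable_ext (fun t => - Num.max (- f t) (- g t))).
  by move=> t; rewrite -oppr_min opprK.
by apply/extendable_opp/extendable_max; exact: extendable_opp.
Qed.

End Extendable.

Context (C : tropical_curve R).
Implicit Types (a : vert C -> R) (f : edge C -> R -> R).

Definition glue a f (x : point C) : R :=
  match x with Vertex v => a v | Inner e r => f e (sval r) end.

Lemma glue_edge a f (e : edge C) (t : R) :
  f e 0 = a (src e) -> (forall L, len e = L%:E -> f e L = a (tgt e)) ->
  0 <= t -> (t%:E <= len e)%E -> glue a f (edge_map e t%:E) = f e t.
Proof.
move=> f0 fL; rewrite le_eqVlt => /orP[/eqP <- _|t0].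
  by rewrite edge_map0.
rewrite le_eqVlt => /orP[/eqP tL|tL].
  by rewrite {1}tL edge_map_len /= -(fL t).
by rewrite (edge_map_inner (introT andP (conj t0 tL))).
Qed.

(** Functions on the edges that agree at the vertices form a rational function,
    because the topology is the one glued from the edges.  The data [a] does
    not prescribe the value at a vertex at infinity: it is the limit along the
    only edge ending there. *)
Lemma repr_in_glue a f :
  (forall e, extendable (len e) (f e)) ->
  (forall e, f e 0 = a (src e)) ->
  (forall e L, len e = L%:E -> f e L = a (tgt e)) ->
  repr_in setT (glue a f).
Proof.
move=> /choice[h hP] f0 fL.
have hf e t : h e t%:E = (f e t)%:E by case: (hP e).
pose b (v : vert C) : \bar R :=
  if [pick e | (len e == +oo%E) && (tgt e == v)] is Some e then h e +oo%E
  else (a v)%:E.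
pose F (x : point C) : \bar R :=
  match x with Vertex v => b v | Inner e r => h e (sval r)%:E end.
have bfin v : ~~ at_infinity (Vertex v : point C) -> b v = (a v)%:E.
  rewrite /b; case: pickP => // e He /existsP[]; by exists e.
have Ffin x : ~~ at_infinity x -> F x = (glue a f x)%:E.
  by case: x => [v|e r _] /=; [exact: bfin|exact: hf].
have Fedge e t : edge_itv e t -> F (edge_map e t) = h e t.
  rewrite /edge_itv /=; case: t => [t| |] // /andP[t0 tl].
    by rewrite Ffin ?edge_map_finite // glue_edge // => L; exact: fL.
  have le : len e = +oo%E by apply/eqP; rewrite -leye_eq.
  have [tgtI _] := leaf_tgtP (infty_leaf le).
  rewrite edge_mapy /= /b; case: pickP => [e' /andP[_ /eqP /tgtI -> //]|].
  by move=> /(_ e); rewrite le !eqxx.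
suff rF : is_rational F by exists (RatFun rF).
right; split.
- apply/continuousP => U oU.
  suff : point_open (F @^-1` U) by exact.
  move=> e; apply/open_subspaceP.
  exists (h e @^-1` U).
    by apply: open_comp => // t _; case: (hP e) => + _ _; exact.
  by apply/seteqP; split=> t [] /= Ut et; split=> //; move: Ut; rewrite Fedge.
- move=> e; have [_ ph _] := hP e; apply: (pa_max (len_gt0 e) _ ph ph) => t.
  by move=> et; rewrite maxxx /= Fedge.
- by move=> x /Ffin ->.
Qed.

End Gluing.

(** * The generators *)

Section Generators.
Context (R : realType) (C : tropical_curve R).

Lemma len_lower_bound : exists2 c : R, 0 < c &
  forall e : edge C, (c%:E <= len e)%E.
Proof.
pose l (e : edge C) := if len e is r%:E then r else 1.
exists (\big[Num.min/1]_e l e).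
  apply: lt_bigmin => // e _; have := len_gt0 e; rewrite /l.
  by case: (len e).
move=> e; have : \big[Num.min/1]_e l e <= l e by exact: bigmin_le_cond.
by have := len_gt0 e; rewrite /l; case: (len e) => [r| |] // _; rewrite leey.
Qed.

(** The value [c] at [v] must decrease to 0 with slope -1 along each edge at
    [v]; this works, also on loops and parallel edges, if [c] is at most the
    length of every edge. *)
Lemma vertex_bump (v : vert C) : exists p, exists2 c : R, 0 < c &
  repr_in setT p /\ forall u : vert C, p (Vertex u) = if u == v then c else 0.
Proof.
have [c c0 cl] := len_lower_bound.
pose a (u : vert C) := if u == v then c else 0.
have a0 u : 0 <= a u by rewrite /a; case: ifP => // _; exact: ltW.
have ac u : a u <= c by rewrite /a; case: ifP => // _; exact: ltW.
pose f (e : edge C) (t : R) := Num.max 0 (Num.max (a (src e) - t)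
  (if len e is L%:E then a (tgt e) + t - L else 0)).
exists (glue a f), c => //; split; last by [].
apply: repr_in_glue => [e|e|e L]; rewrite /f.
- have l0 := len_gt0 e.
  apply: (extendable_max l0); last apply: (extendable_max l0).
  + by apply: extendable_ext (extendable_affine l0 0 0) => t; lra.
  + by apply: extendable_ext (extendable_affine l0 (-1) (a (src e))) => t; lra.
  + case: (len e) l0 => [L| |] l0.
    * by apply: extendable_ext (extendable_affine l0 1 (a (tgt e) - L)) => t; lra.
    * by apply: extendable_ext (extendable_affine l0 0 0) => t; lra.
    * by apply: extendable_ext (extendable_affine l0 0 0) => t; lra.
- have := cl e; have := a0 (src e); have := ac (tgt e).
  by case: (len e) => [L| |]; rewrite ?lee_fin; lra_maxmin.
- move=> eL; have := cl e; rewrite eL lee_fin.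
  by have := ac (src e); have := a0 (tgt e); lra_maxmin.
Qed.


(** A function on one edge with the same value [c] at both ends extends by [c];
    this includes loops. *)
Lemma repr_in_edge (e : edge C) (c : R) (f : R -> R) :
  extendable (len e) f -> f 0 = c -> (forall L, len e = L%:E -> f L = c) ->
  exists2 p, repr_in setT p &
    (forall t : R, 0 <= t -> (t%:E <= len e)%E -> p (edge_map e t%:E) = f t) /\
    (forall x, p x = c \/
       exists t : R, [/\ 0 <= t, (t%:E <= len e)%E & x = edge_map e t%:E]).
Proof.
move=> ef f0 fL; pose h e' := if e' == e then f else fun=> c.
have h0 e' : h e' 0 = c by rewrite /h; case: ifP.
have hL e' L : len e' = L%:E -> h e' L = c.
  by rewrite /h; case: eqP => [->|//]; exact: fL.
exists (glue (fun=> c) h).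
  apply: repr_in_glue => // e'; rewrite /h; case: eqP => [->//|_].
  by apply: extendable_ext (extendable_affine (len_gt0 e') 0 c) => t; lra.
split=> [t t0 tl|[v|e' r]]; first by rewrite glue_edge // /h eqxx.
  by left.
rewrite /= /h; case: eqP => [ee|]; last by left.
right; subst e'; case: r => r Hr; exists r; have /andP[r0 rl] := Hr.
by rewrite (edge_map_inner Hr); split=> //; exact: ltW.
Qed.

(** [T] is a coordinate of the edge [e] on the open set where the weight [w]
    is positive, and this set lies in [e]. *)
Definition chart (e : edge C) (T w : point C -> R) :=
  [/\ repr_in setT T, repr_in setT w, forall x, 0 <= w x &
    forall x, 0 < w x -> exists t : R,
      [/\ 0 <= t, (t%:E <= len e)%E, x = edge_map e t%:E & T x = t]].

Lemma edge_chart (e : edge C) (c : R) (f g : R -> R) :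
  extendable (len e) f -> f 0 = c -> (forall L, len e = L%:E -> f L = c) ->
  extendable (len e) g -> g 0 = 0 -> (forall L, len e = L%:E -> g L = 0) ->
  (forall t, 0 <= t -> (t%:E <= len e)%E -> 0 <= g t /\ (0 < g t -> f t = t)) ->
  exists T w, chart e T w /\
    forall t : R, 0 <= t -> (t%:E <= len e)%E -> w (edge_map e t%:E) = g t.
Proof.
move=> ef f0 fL eg g0 gL fg.
have [T rT [TE _]] := repr_in_edge ef f0 fL.
have [w rw [wE w0]] := repr_in_edge eg g0 gL.
exists T, w; split=> //; split=> // x.
  have [->//|[t [t0 tl ->]]] := w0 x.
  by rewrite wE //; have [] := fg t t0 tl.
have [->|[t [t0 tl ->]]] := w0 x; first by rewrite ltxx.
rewrite wE // => gt; exists t; rewrite TE //; split=> //.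
by have [_ ->] := fg t t0 tl.
Qed.

(** The weights are tents of slope 1, on [[0, 2L/3]] and on [[L/3, L]].  On
    the half [t <= L/2] the first one is at least [t/3]: beyond its top
    at [L/3] it is [2L/3 - t >= L/6 >= t/3].  By symmetry the second one is at
    least [(L - t)/3] on the other half.  The factor 3 in the conclusion comes
    from this, and turns a Lipschitz bound on a function that vanishes at the
    ends into a bound by a multiple of a weight.  In the chart on [[L/3, L]]
    the function [T] is [max t (L - 2t)], which is [L] at both ends and
    therefore extends by [L]. *)
Lemma edge_charts (e : edge C) : exists T w : bool -> point C -> R,
  (forall b, chart e (T b) (w b)) /\
  forall t : R, 0 <= t -> (t%:E <= len e)%E -> exists b,
    t <= 3 * w b (edge_map e t%:E) \/
    (len e <= (t + 3 * w b (edge_map e t%:E))%:E)%E.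
Proof.
have l0 := len_gt0 e.
have aff (k : int) c : extendable (len e) (fun t => k%:~R * t + c).
  exact: extendable_affine.
have := l0; case le: (len e) => [L| |] // L0; last first.
  have eid : extendable (len e) id.
    by apply: extendable_ext (aff 1 0) => t; lra.
  have [|||||||T [w [Tw wE]]] := @edge_chart e 0 id id => //.
  - by rewrite le.
  - by rewrite le.
  exists (fun=> T), (fun=> w); split=> // t t0 tl; exists true; left.
  by rewrite wE ?le //; lra_maxmin.
rewrite lte_fin in L0.
have [|||||||T1 [w1 [Tw1 w1E]]] := @edge_chart e 0
  (fun t => Num.min t (2 * L - 2 * t))
  (fun t => Num.max 0 (Num.min t (2 * L / 3 - t))).
- apply: (extendable_min l0).
  + by apply: extendable_ext (aff 1 0) => t; lra.
  + by apply: extendable_ext (aff (-2) (2 * L)) => t; lra.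
- by lra_maxmin.
- by move=> ?; rewrite le => -[<-]; lra_maxmin.
- apply: (extendable_max l0); last apply: (extendable_min l0).
  + by apply: extendable_ext (aff 0 0) => t; lra.
  + by apply: extendable_ext (aff 1 0) => t; lra.
  + by apply: extendable_ext (aff (-1) (2 * L / 3)) => t; lra.
- by lra_maxmin.
- by move=> ?; rewrite le => -[<-]; lra_maxmin.
- by move=> t t0; rewrite le lee_fin => tL; split; lra_maxmin.
have [|||||||T2 [w2 [Tw2 w2E]]] := @edge_chart e L
  (fun t => Num.max t (L - 2 * t))
  (fun t => Num.max 0 (Num.min (t - L / 3) (L - t))).
- apply: (extendable_max l0).
  + by apply: extendable_ext (aff 1 0) => t; lra.
  + by apply: extendable_ext (aff (-2) L) => t; lra.
- by lra_maxmin.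
- by move=> ?; rewrite le => -[<-]; lra_maxmin.
- apply: (extendable_max l0); last apply: (extendable_min l0).
  + by apply: extendable_ext (aff 0 0) => t; lra.
  + by apply: extendable_ext (aff 1 (- L / 3)) => t; lra.
  + by apply: extendable_ext (aff (-1) L) => t; lra.
- by lra_maxmin.
- by move=> ?; rewrite le => -[<-]; lra_maxmin.
- by move=> t t0; rewrite le lee_fin => tL; split; lra_maxmin.
exists (fun b => if b then T1 else T2), (fun b => if b then w1 else w2).
split=> [[]//|t t0 tl]; have tL : t <= L by rewrite -lee_fin.
have [tL2|Lt2] := leP t (L / 2); [exists true; left|exists false; right].
  by rewrite w1E ?le //; lra_maxmin.
by rewrite w2E ?le // lee_fin; lra_maxmin.
Qed.

End Generators.

(** * Generation *)

Section Generation.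
Context (R : realType) (C : tropical_curve R).
Implicit Types (p h : point C -> R).

Lemma finite_set_representing (I : finType) (p : I -> point C -> R) :
  (forall i, repr_in setT (p i)) ->
  exists2 G : set (ratfun C), finite_set G &
    forall A, G `<=` A -> forall i, repr_in A (p i).
Proof.
move=> rp; have /choice[g gp] : forall i, exists g : ratfun C,
  forall x, ~~ at_infinity x -> g x = (p i x)%:E.
  by move=> i; have [g _ gp] := rp i; exists g.
exists (range g); first exact: finite_image.
by move=> A GA i; exists (g i); [by apply: GA; exists i|exact: gp].
Qed.

(** The generated subsemifield is an intersection; each [A] to be intersected
    is treated on its own. *)
Section InSubsemifield.
Context (A : set (ratfun C)) (sA : is_subsemifield A).
Context (cA : range (@ratfun_cst R C) `<=` A).

Section Charts.
Context (T w : edge C -> bool -> point C -> R).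
Context (chartTw : forall e b, chart e (T e b) (w e b)).
Context (cover : forall (e : edge C) (t : R), 0 <= t -> (t%:E <= len e)%E ->
  exists b, t <= 3 * w e b (edge_map e t%:E) \/
    (len e <= (t + 3 * w e b (edge_map e t%:E))%:E)%E).
Context (TA : forall e b, repr_in A (T e b)).
Context (wA : forall e b, repr_in A (w e b)).

(** On its chart, each term of the maximum is [min h (n * w)], and it is 0
    elsewhere; so the maximum is at most [h].  It reaches [h] because
    [h <= n * w] in some chart at each point of an edge. *)
Lemma repr_in_vanishing_ge0 h : repr_in setT h ->
  (forall x, ~~ at_infinity x -> 0 <= h x) ->
  (forall v : vert C, ~~ at_infinity (Vertex v : point C) ->
    h (Vertex v) = 0) ->
  repr_in A h.
Proof.
move=> rh h0 hv.
have /choice[f /all_and2[pf hf]] : forall e : edge C, exists f, plfun f /\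
    forall t : R, 0 <= t -> (t%:E <= len e)%E -> h (edge_map e t%:E) = f t.
  by move=> e; have [f] := repr_on_edge e rh; exists f.
have /choice[n hn] e := plfun_lipschitz (pf e).
have f0 e : f e 0 = 0.
  by rewrite -hf //; [rewrite edge_map0 hv // src_finite|exact/ltW/len_gt0].
have fL e L : len e = L%:E -> f e L = 0.
  move=> eL; have L0 : 0 <= L by rewrite -lee_fin -eL; exact/ltW/len_gt0.
  rewrite -hf ?eL //; have : (L%:E <= len e)%E by rewrite eL.
  by move=> /(edge_map_finite L0); rewrite -eL edge_map_len => /hv.
pose q (i : edge C * bool) x :=
  Num.min (Num.max (f i.1 (T i.1 i.2 x)) 0) ((3 * n i.1)%N%:R * w i.1 i.2 x).
have qA : repr_in A (fun x => \big[Num.max/0]_(i : edge C * bool) q i x).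
  apply: repr_in_bigmax => // -[e b]; apply: repr_in_min => //.
    apply: repr_in_max => //; [exact: repr_in_plfun|exact: repr_in_cst].
  exact: repr_in_muln.
apply: repr_in_ext qA => x xf; apply: le_anti; apply/andP; split.
  apply: bigmax_le => [|[e b] _]; first exact: h0.
  rewrite /q /= ge_min; have [_ _ w0 Hw] := chartTw e b.
  have := w0 x; rewrite le_eqVlt => /orP[/eqP <-|/Hw].
    by rewrite mulr0 h0 ?orbT.
  by case=> t [t0 tl xE ->]; rewrite -hf // -xE max_l ?lexx // h0.
have q_le i : h x <= q i x -> h x <= \big[Num.max/0]_i q i x.
  by move=> /le_trans; apply; exact: le_bigmax.
case: x xf q_le => [v /hv ->|e [r Hr] xf q_le]; first by rewrite bigmax_ge_id.
have /andP[/ltW r0 /ltW rl] := Hr.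
move: xf q_le; rewrite -(edge_map_inner Hr) => xf q_le.
(* [n e] is a Lipschitz constant of [h] on [e]; the bound starts from the end
   of [e] for which the cover gives an estimate. *)
have [b Hb] := cover r0 rl; apply: (q_le (e, b)); rewrite /q /=.
set W := w e b _ in Hb *.
have hr : h (edge_map e r%:E) <= (3 * n e)%N%:R * W.
  rewrite hf // natrM (mulrC 3) -mulrA.
  case: Hb => Hb.
    have := hn e r 0; rewrite f0 !subr0 (ger0_norm r0).
    move=> /(le_trans (ler_norm _)).
    by move=> /le_trans; apply; rewrite ler_wpM2l.
  have [L eL] : exists L, len e = L%:E.
    have := len_gt0 e; case: (len e) Hb => [L| |] //; by exists L.
  have Lr : L - r <= 3 * W by move: Hb; rewrite eL lee_fin lerBlDl.
  have := hn e r L.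
  rewrite (fL e L eL) subr0 distrC (@ger0_norm _ (L - r)); last first.
    by rewrite subr_ge0 -lee_fin -eL.
  move=> /(le_trans (ler_norm _)) /le_trans; apply.
  by rewrite ler_wpM2l.
rewrite le_min hr andbT le_max; have [_ _ _ Hw] := chartTw e b.
have [W0|W0] := ltP 0 W.
  by have [t [t0 tl xE ->]] := Hw _ W0; rewrite -hf // -xE lexx.
by apply/orP; right; apply: le_trans hr _; rewrite mulr_ge0_le0.
Qed.

Context (bump : vert C -> point C -> R) (c : vert C -> R).
Context (bumpA : forall v, repr_in A (bump v)) (c_gt0 : forall v, 0 < c v).
Context (bumpE : forall v u, bump v (Vertex u) = if u == v then c v else 0).

(** For [r >= 0] and [n c >= r], the function [n * bump v] lowered by [n c - r]
    is [r] at [v] and nonpositive at the other vertices. *)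
Lemma repr_in_vertex_value (v : vert C) (r : R) : exists p, repr_in A p /\
  forall u : vert C, p (Vertex u) = if u == v then r else 0.
Proof.
wlog r0 : r / 0 <= r.
  move=> W; have [/W//|/ltW] := leP 0 r.
  rewrite -oppr_ge0 => /W[p [Ap pE]]; exists (fun x => - p x); split.
    exact: repr_in_opp.
  by move=> u; rewrite pE; case: ifP; rewrite ?opprK ?oppr0.
pose n := Num.bound (r / c v).
exists (fun x => Num.max 0 (n%:R * bump v x + (r - n%:R * c v))); split.
  apply: repr_in_max => //; first exact: repr_in_cst.
  apply: repr_in_add => //; last exact: repr_in_cst.
  exact: repr_in_muln.
move=> u; rewrite bumpE; case: ifP => _.
  by rewrite addrCA subrr addr0 max_r.
rewrite mulr0 add0r max_l // subr_le0 -ler_pdivrMr //.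
by apply: ltW; rewrite archi_boundP // divr_ge0 // ltW.
Qed.

Lemma repr_in_vertex_values (a : vert C -> R) : exists2 p, repr_in A p &
  forall v : vert C, p (Vertex v) = a v.
Proof.
have /choice[p /all_and2[Ap pE]] v := repr_in_vertex_value v (a v).
exists (fun x => \sum_v p v x); first exact: repr_in_sum.
move=> v; rewrite (bigD1 v) //= pE eqxx big1 ?addr0 // => u uv.
by rewrite pE eq_sym (negPf uv).
Qed.

Lemma repr_in_all p : repr_in setT p -> repr_in A p.
Proof.
move=> rp; have [F AF FE] := repr_in_vertex_values (fun v => p (Vertex v)).
have sT := is_subsemifieldT C.
have cT : range (@ratfun_cst R C) `<=` setT by [].
have rg : repr_in setT (fun x => p x - F x).
  apply: repr_in_add => //; apply: repr_in_opp => //.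
  exact: repr_inS AF.
have part (g : point C -> R) : repr_in setT g ->
    (forall v : vert C, g (Vertex v) = 0) ->
    repr_in A (fun x => Num.max (g x) 0).
  move=> {}rg gv; apply: repr_in_vanishing_ge0 => [|x _|v _].
  - by apply: repr_in_max => //; exact: repr_in_cst.
  - by rewrite le_max lexx orbT.
  - by rewrite gv maxxx.
have Ag : repr_in A (fun x =>
    F x + (Num.max (p x - F x) 0 - Num.max (- (p x - F x)) 0)).
  apply: repr_in_add => //; apply: repr_in_add => //.
    by apply: part => // v; rewrite FE subrr.
  apply: repr_in_opp => //; apply: part; first exact: repr_in_opp.
  by move=> v; rewrite FE subrr oppr0.
by apply: repr_in_ext Ag => x _; lra_maxmin.
Qed.

End Charts.
End InSubsemifield.
End Generation.

Theorem theorem1p1 (R : realType) (C : tropical_curve R) :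
  fg_semifield_over (@ratfun_cst R C : {rmorphism tropical R -> ratfun C}).
Proof.
have /choice[bump /choice[c /all_and2[c_gt0 /all_and2[rbump bumpE]]]] :
    forall v : vert C, exists p, exists c : R, 0 < c /\
      (repr_in setT p /\ forall u, p (Vertex u) = if u == v then c else 0).
  by move=> v; have [p [c]] := vertex_bump v; exists p, c.
have /choice[T /choice[w /all_and2[chartTw cover]]] := @edge_charts R C.
have [GT fGT TG] := finite_set_representing
  (p := fun i : edge C * bool => T i.1 i.2)
  (fun i => let: And4 H _ _ _ := chartTw i.1 i.2 in H).
have [Gw fGw wG] := finite_set_representing
  (p := fun i : edge C * bool => w i.1 i.2)
  (fun i => let: And4 _ H _ _ := chartTw i.1 i.2 in H).
have [Gb fGb bG] := finite_set_representing rbump.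
exists (GT `|` Gw `|` Gb); split; first by rewrite !finite_setU.
apply/seteqP; split=> // f _ A [sA].
rewrite !subUset => -[cA [[TA wA] bA]].
have [->|f0] := eqVneq f 0; first by case: sA.
have ff x : ~~ at_infinity x -> f x = (fine (f x))%:E.
  move=> xf; rewrite fineK //; case: (ratfunP f) => [fN|[_ _ ->//]].
  by move/eqP: f0; case; apply: ratfun_ext => y _; rewrite fN.
have rf : repr_in setT (fun x => fine (f x)) by exists f.
have [g Ag gf] := repr_in_all sA cA chartTw cover
  (fun e b => TG A TA (e, b)) (fun e b => wG A wA (e, b))
  (bG A bA) c_gt0 bumpE rf.
by rewrite (_ : f = g) //; apply: ratfun_ext => x xf; rewrite ff // gf.
Qed.
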